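(* Let $\gamma\in[0,2]$, $\omega>0$, $n\in\mathbb{R}\setminus\{-2\}$, $\lambda\ge0$ and $V_0>0$ be constants. (a) (Self-interacting Sáez-Ballester cosmology.) Let $$V(\phi)=V_0\exp\left(-\frac{2\sqrt{6\omega}\,\lambda}{n+2}\,\phi^{1+n/2}\right)$$ and let $H(t)>0$, $\rho_m(t)$, $\phi(t)>0$ be smooth functions of cosmic time $t$ on an interval satisfying $$3H^2=\rho_m+\tfrac{\omega}{2}\phi^n\dot\phi^2+V(\phi),\quad 2\dot H=-\gamma\rho_m-\omega\phi^n\dot\phi^2,$$ $$\ddot\phi+3H\dot\phi+\tfrac n2\frac{\dot\phi^2}{\phi}=-\frac{1}{\omega\phi^n}\frac{dV}{d\phi}(\phi),\quad \dot\rho_m+3\gamma H\rho_m=0 .$$ Then $$x:=\sqrt{\frac{\omega}{6}}\,\phi^{n/2}\,\frac{\dot\phi}{H},\qquad y:=\frac{\sqrt{V(\phi)}}{\sqrt3\,H}$$ satisfy the closed autonomous system $$x'=-3x\left[1-x^2-\tfrac{\gamma}{2}(1-x^2-y^2)\right]+3\lambda y^2,\qquad y'=3y\left[-\lambda x+x^2+\tfrac{\gamma}{2}(1-x^2-y^2)\right].$$ (b) (Einstein-scalar cosmology with exponential potential.) Let $V(\varphi)=V_0\exp(-\sqrt6\,\lambda\varphi)$ and let $H(t)>0$, $\rho_m(t)$, $\varphi(t)$ be smooth functions on an interval satisfying $$3H^2=\rho_m+\tfrac12\dot\varphi^2+V(\varphi),\quad 2\dot H=-\gamma\rho_m-\dot\varphi^2,\quad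 \ddot\varphi+3H\dot\varphi=-\frac{dV}{d\varphi}(\varphi),\quad \dot\rho_m+3\gamma H\rho_m=0 .$$ Then $x:=\dot\varphi/(\sqrt6 H)$ and $y:=\sqrt{V(\varphi)}/(\sqrt3 H)$ satisfy the same autonomous system as in (a). Moreover, the redefinition $\varphi=\frac{2\sqrt\omega}{n+2}\phi^{(n+2)/2}$ transforms the potential in (a) into the potential in (b).
   Context: Dots denote derivatives with respect to cosmic time $t$; the prime denotes the derivative with respect to $\tau=\int H\,dt$, i.e. $f'=\dot f/H$. $H$ is the Hubble parameter of a flat Friedmann-Robertson-Walker metric (expanding universe) and $\rho_m$ the energy density of a fluid with pressure $p_m=(\gamma-1)\rho_m$. *)

(* Defs.v *)
From Stdlib Require Import Reals.
From Coquelicot Require Import Coquelicot.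
Open Scope R_scope.

(* An interval of any kind (open, closed, half-open, unbounded), given by its
   indicator predicate. Two distinct points are required because derivatives
   relative to a single point are meaningless. *)
Definition is_interval (I : R -> Prop) : Prop :=
  (forall a b t, I a -> I b -> a <= t <= b -> I t) /\
  (exists a b, I a /\ I b /\ a < b).

(* [D_in] takes the limit of the difference quotient along points of [I] only:
   it is the usual derivative at interior points of [I] and the one-sided
   derivative at an end point belonging to [I]. *)
Definition is_dot (I : R -> Prop) (f : R -> R) (t l : R) : Prop :=
  D_in f (fun _ => l) I t.

Definition ex_dot (I : R -> Prop) (f : R -> R) (t : R) : Prop :=
  exists l, is_dot I f t l.

(* A total operator: its value is meaningful only where [ex_dot I f t], since
   [iota P] is the element satisfying [P] when there is exactly one. *)
Definition dot (I : R -> Prop) (f : R -> R) (t : R) : R :=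
  iota (fun l : R => is_dot I f t l).

Definition smooth_on (I : R -> Prop) (f : R -> R) : Prop :=
  forall (k : nat) (t : R), I t -> ex_dot I (Nat.iter k (dot I) f) t.

(* f' = (df/dt) / H, the derivative with respect to tau = int H dt. *)
Definition prime (I : R -> Prop) (H f : R -> R) (t : R) : R :=
  dot I f t / H t.

(* [Rpower] is the real power for a positive base. *)
Definition V_SB (omega n lambda V0 phi : R) : R :=
  V0 * exp (- (2 * sqrt (6 * omega) * lambda / (n + 2)
               * Rpower phi (1 + n / 2))).

Definition V_E (lambda V0 phi : R) : R :=
  V0 * exp (- (sqrt 6 * lambda * phi)).

Record SB_solution (gamma omega n : R) (V : R -> R) (I : R -> Prop)
    (H rho phi : R -> R) : Prop := {
  SB_smooth_H : smooth_on I H;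
  SB_smooth_rho : smooth_on I rho;
  SB_smooth_phi : smooth_on I phi;
  SB_H_pos : forall t, I t -> 0 < H t;
  SB_phi_pos : forall t, I t -> 0 < phi t;
  SB_friedmann : forall t, I t ->
    3 * H t ^ 2 =
      rho t + omega / 2 * Rpower (phi t) n * dot I phi t ^ 2 + V (phi t);
  SB_raychaudhuri : forall t, I t ->
    2 * dot I H t =
      - gamma * rho t - omega * Rpower (phi t) n * dot I phi t ^ 2;
  SB_klein_gordon : forall t, I t ->
    dot I (dot I phi) t + 3 * H t * dot I phi t
      + n / 2 * (dot I phi t ^ 2 / phi t) =
    - (1 / (omega * Rpower (phi t) n)) * Derive V (phi t);
  SB_conservation : forall t, I t ->
    dot I rho t + 3 * gamma * H t * rho t = 0
}.

Record E_solution (gamma : R) (V : R -> R) (I : R -> Prop)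
    (H rho phi : R -> R) : Prop := {
  E_smooth_H : smooth_on I H;
  E_smooth_rho : smooth_on I rho;
  E_smooth_phi : smooth_on I phi;
  E_H_pos : forall t, I t -> 0 < H t;
  E_friedmann : forall t, I t ->
    3 * H t ^ 2 = rho t + 1 / 2 * dot I phi t ^ 2 + V (phi t);
  E_raychaudhuri : forall t, I t ->
    2 * dot I H t = - gamma * rho t - dot I phi t ^ 2;
  E_klein_gordon : forall t, I t ->
    dot I (dot I phi) t + 3 * H t * dot I phi t = - Derive V (phi t);
  E_conservation : forall t, I t ->
    dot I rho t + 3 * gamma * H t * rho t = 0
}.

Definition autonomous_system (gamma lambda : R) (I : R -> Prop)
    (H x y : R -> R) : Prop :=
  forall t, I t ->
    ex_dot I x t /\ ex_dot I y t /\
    prime I H x t =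
      - 3 * x t * (1 - x t ^ 2 - gamma / 2 * (1 - x t ^ 2 - y t ^ 2))
      + 3 * lambda * y t ^ 2 /\
    prime I H y t =
      3 * y t * (- lambda * x t + x t ^ 2
                 + gamma / 2 * (1 - x t ^ 2 - y t ^ 2)).

(* Main.v *)
Require Import Defs.
From Stdlib Require Import Reals Lra FunctionalExtensionality.
From Coquelicot Require Import Coquelicot.
Open Scope R_scope.

(** Both cosmologies are governed by the scalar velocity [u] ([dphi/dt] in the
    Einstein case, [sqrt omega * phi^(n/2) * dphi/dt] in the Saez-Ballester case)
    and the potential [W] along the trajectory. In either case
    [du/dt + 3 H u = sqrt 6 lambda W] and [dW/dt = - sqrt 6 lambda W u], since
    [d/dt (phi^(n/2) dphi/dt)] absorbs the term [n/2 (dphi/dt)^2 / phi]; the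
    autonomous system follows from these two equations and the two equations
    for [H]. *)

(** * Derivatives relative to an interval *)

(** Of the two distinct points of [I], at least one differs from [t]; moving slightly towards it
    stays in [I] by convexity. This makes limits along [I] at [t] unique. *)
Lemma is_interval_adherent (I : R -> Prop) (t : R) :
  is_interval I -> I t -> adhDa (D_x I t) t.
Proof.
intros [conv [a [b [Ia [Ib ab]]]]] It eps eps_pos.
destruct (Rlt_dec t b) as [tb | tb].
(* Truncating at [b] keeps [s] in [I]; the half makes the distance to [t] strictly less than
   [eps]. *)
- set (s := Rmin b (t + eps / 2)).
  assert (s_bounds : t < s /\ s <= b /\ s <= t + eps / 2).
  { unfold s; repeat split.
    - apply Rmin_glb_lt; lra.
    - apply Rmin_l.
    - apply Rmin_r. }
  exists s; split.
  + split; [apply (conv t b); trivial; lra | lra].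
  + unfold Rdist; rewrite Rabs_pos_eq; lra.
- set (s := Rmax a (t - eps / 2)).
  assert (s_bounds : s < t /\ a <= s /\ t - eps / 2 <= s).
  { unfold s; repeat split.
    - apply Rmax_lub_lt; lra.
    - apply Rmax_l.
    - apply Rmax_r. }
  exists s; split.
  + split; [apply (conv a t); trivial; lra | lra].
  + unfold Rdist; rewrite Rabs_left; lra.
Qed.

(** Limits at an adherent point are unique, so [iota] returns the derivative found by the calculus
    rules. *)
Lemma dot_unique (I : R -> Prop) (f : R -> R) (t l : R) :
  is_interval I -> I t -> is_dot I f t l -> dot I f t = l.
Proof.
intros HI It fl; unfold dot.
apply (iota_unique (V := R_CompleteNormedModule)); [intros l' fl' | exact fl].
exact (single_limit _ _ _ _ _ (is_interval_adherent I t HI It) fl' fl).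
Qed.

Lemma ex_dot_correct (I : R -> Prop) (f : R -> R) (t : R) :
  is_interval I -> I t -> ex_dot I f t -> is_dot I f t (dot I f t).
Proof.
intros HI It [l fl]; rewrite (dot_unique I f t l HI It fl); exact fl.
Qed.

Lemma is_dot_const (I : R -> Prop) (c t : R) : is_dot I (fun _ => c) t 0.
Proof. exact (Dconst I c t). Qed.

Lemma is_dot_mult (I : R -> Prop) (f g : R -> R) (t f' g' : R) :
  is_dot I f t f' -> is_dot I g t g' ->
  is_dot I (fun s => f s * g s) t (f' * g t + f t * g').
Proof.
intros ff gg.
exact (Dmult I (fun _ => f') (fun _ => g') f g t ff gg).
Qed.

Lemma is_dot_comp (I : R -> Prop) (f g : R -> R) (t f' g' : R) :
  is_dot I f t f' -> is_derive g (f t) g' ->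
  is_dot I (fun s => g (f s)) t (g' * f').
Proof.
intros ff gg.
apply is_derive_Reals in gg.
assert (gD : D_in g (fun _ => g') no_cond (f t)).
{ exact (proj2 (derivable_pt_lim_D_in g (fun _ => g') (f t)) gg). }
(* [Dcomp] gives the limit over the domain [Dgf I no_cond f], with the factors in the order
   [f' * g']; unfolding to epsilon-delta form reconciles both. *)
pose proof (Dcomp I no_cond (fun _ => f') (fun _ => g') f g t ff gD) as c.
unfold is_dot, D_in, limit1_in, limit_in in *.
intros eps eps_pos.
destruct (c eps eps_pos) as [d [d_pos Hd]].
exists d; split; [exact d_pos |].
intros s [[Is ts] ds]; rewrite (Rmult_comm g').
apply Hd; repeat split; trivial.
Qed.

Lemma is_dot_div (I : R -> Prop) (f g : R -> R) (t f' g' : R) :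
  g t <> 0 -> is_dot I f t f' -> is_dot I g t g' ->
  is_dot I (fun s => f s / g s) t ((f' * g t - f t * g') / g t ^ 2).
Proof.
intros g0 ff gg.
replace ((f' * g t - f t * g') / g t ^ 2)
  with (f' * / g t + f t * (- / g t ^ 2 * g')) by (field; exact g0).
apply (is_dot_mult I f (fun s => / g s)); [exact ff |].
apply (is_dot_comp I g Rinv); [exact gg |].
auto_derive; [exact g0 | field; exact g0].
Qed.

(** * Square roots and real powers *)

Lemma is_derive_sqrt_pos (w : R) : 0 < w -> is_derive sqrt w (/ (2 * sqrt w)).
Proof.
intro w0; apply is_derive_Reals; exact (derivable_pt_lim_sqrt w w0).
Qed.

(** Serves to write the kinetic term [omega * phi^n * (dphi/dt)^2] as the square of the scalar
    velocity. *)
Lemma Rpower_half_sqr (a b : R) : Rpower a b = Rpower a (b / 2) ^ 2.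
Proof.
simpl; rewrite Rmult_1_r, <- Rpower_plus; f_equal; field.
Qed.

Lemma is_derive_Rpower (a p : R) :
  0 < p -> is_derive (fun q => Rpower q a) p (a * Rpower p (a - 1)).
Proof.
intro p0; apply is_derive_Reals; exact (derivable_pt_lim_power p a p0).
Qed.

(** * The autonomous system from the scalar velocity *)

Lemma autonomous_system_of_velocity (gamma lambda : R) (I : R -> Prop)
    (H rho u W : R -> R) (H' u' W' : R -> R) :
  is_interval I ->
  (forall t, I t -> 0 < H t) -> (forall t, I t -> 0 < W t) ->
  (forall t, I t -> is_dot I H t (H' t)) ->
  (forall t, I t -> is_dot I u t (u' t)) ->
  (forall t, I t -> is_dot I W t (W' t)) ->
  (forall t, I t -> 3 * H t ^ 2 = rho t + 1 / 2 * u t ^ 2 + W t) ->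
  (forall t, I t -> 2 * H' t = - gamma * rho t - u t ^ 2) ->
  (forall t, I t -> u' t + 3 * H t * u t = sqrt 6 * lambda * W t) ->
  (forall t, I t -> W' t = - (sqrt 6 * lambda * u t) * W t) ->
  autonomous_system gamma lambda I H
    (fun t => u t / (sqrt 6 * H t)) (fun t => sqrt (W t) / (sqrt 3 * H t)).
Proof.
intros HI H_pos W_pos dH du dW friedmann raychaudhuri klein_gordon potential t It.
specialize (H_pos t It); specialize (W_pos t It); specialize (dH t It).
specialize (du t It); specialize (dW t It); specialize (friedmann t It).
specialize (raychaudhuri t It); specialize (klein_gordon t It).
specialize (potential t It).
assert (r3 : 0 < sqrt 3) by (apply sqrt_lt_R0; lra).
assert (r6 : 0 < sqrt 6) by (apply sqrt_lt_R0; lra).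
assert (rW : 0 < sqrt (W t)) by (apply sqrt_lt_R0; exact W_pos).
assert (r3_sqr : sqrt 3 ^ 2 = 3) by (apply pow2_sqrt; lra).
assert (r6_sqr : sqrt 6 ^ 2 = 6) by (apply pow2_sqrt; lra).
assert (rW_sqr : sqrt (W t) ^ 2 = W t) by (apply pow2_sqrt; lra).
assert (dHc : forall c, is_dot I (fun s => c * H s) t (c * H' t)).
{ intro c; replace (c * H' t) with (0 * H t + c * H' t) by ring.
  apply (is_dot_mult I (fun _ => c)); [apply is_dot_const | exact dH]. }
assert (dx : is_dot I (fun s => u s / (sqrt 6 * H s)) t
    ((u' t * (sqrt 6 * H t) - u t * (sqrt 6 * H' t)) / (sqrt 6 * H t) ^ 2)).
{ apply (is_dot_div I u (fun s => sqrt 6 * H s)); [| exact du | apply dHc].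
  apply Rgt_not_eq, Rmult_lt_0_compat; trivial. }
assert (dy : is_dot I (fun s => sqrt (W s) / (sqrt 3 * H s)) t
    ((/ (2 * sqrt (W t)) * W' t * (sqrt 3 * H t)
      - sqrt (W t) * (sqrt 3 * H' t)) / (sqrt 3 * H t) ^ 2)).
{ apply (is_dot_div I (fun s => sqrt (W s)) (fun s => sqrt 3 * H s));
    [| | apply dHc].
  - apply Rgt_not_eq, Rmult_lt_0_compat; trivial.
  - apply (is_dot_comp I W sqrt); [exact dW | apply is_derive_sqrt_pos, W_pos]. }
set (x := u t / (sqrt 6 * H t)); set (y := sqrt (W t) / (sqrt 3 * H t)).
assert (y_pos : 0 < y).
{ apply Rdiv_lt_0_compat; [| apply Rmult_lt_0_compat]; trivial. }
(* Everything is now expressed through [x], [y] and [H], so that both equations become rational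
   identities. *)
assert (ux : u t = x * (sqrt 6 * H t)) by (unfold x; field; lra).
assert (Wy : sqrt (W t) = y * (sqrt 3 * H t)) by (unfold y; field; lra).
assert (Wyy : W t = 3 * y ^ 2 * H t ^ 2).
{ rewrite <- rW_sqr, Wy, !Rpow_mult_distr, r3_sqr; ring. }
assert (uxx : u t ^ 2 = 6 * x ^ 2 * H t ^ 2).
{ rewrite ux, !Rpow_mult_distr, r6_sqr; ring. }
(* The Friedmann equation reads [rho = 3 * H^2 * (1 - x^2 - y^2)], which closes the system by
   eliminating [rho]. *)
assert (Hxy : H' t =
    - (3 * x ^ 2 + 3 * gamma / 2 * (1 - x ^ 2 - y ^ 2)) * H t ^ 2).
{ replace (rho t) with (3 * H t ^ 2 - 1 / 2 * u t ^ 2 - W t)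
    in raychaudhuri by lra.
  rewrite uxx, Wyy in raychaudhuri; lra. }
repeat split; [eexists; exact dx | eexists; exact dy | |]; unfold prime.
- rewrite (dot_unique I _ t _ HI It dx).
  replace (u' t) with (sqrt 6 * lambda * W t - 3 * H t * u t) by lra.
  rewrite Hxy, Wyy, ux; field; lra.
- rewrite (dot_unique I _ t _ HI It dy).
  (* The factor 6 is [sqrt 6] from the potential times [sqrt 6] from [u]. Keeping [W] as a squared
     root lets it cancel the [/ (2 * sqrt (W t))] of the chain rule. *)
  assert (W'y : W' t = - (6 * lambda * x * H t) * sqrt (W t) ^ 2).
  { rewrite potential, ux, rW_sqr; rewrite <- r6_sqr at 3; ring. }
  rewrite W'y, Hxy, Wy; field; lra.
Qed.

(** * The two potentials and their cosmologies *)

Lemma V_E_pos (lambda V0 p : R) : 0 < V0 -> 0 < V_E lambda V0 p.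
Proof. intro V0_pos; apply Rmult_lt_0_compat; [exact V0_pos | apply exp_pos]. Qed.

Lemma V_SB_pos (omega n lambda V0 p : R) :
  0 < V0 -> 0 < V_SB omega n lambda V0 p.
Proof. intro V0_pos; apply Rmult_lt_0_compat; [exact V0_pos | apply exp_pos]. Qed.

Lemma is_derive_V_E (lambda V0 p : R) :
  is_derive (V_E lambda V0) p (- (sqrt 6 * lambda) * V_E lambda V0 p).
Proof. unfold V_E; auto_derive; [trivial | ring]. Qed.

(** The power [1 + n / 2] brings down a factor [(n + 2) / 2], which cancels the [2 / (n + 2)] in the
    exponent. *)
Lemma is_derive_V_SB (omega n lambda V0 p : R) :
  n <> -2 -> 0 < p ->
  is_derive (V_SB omega n lambda V0) p
    (- (sqrt (6 * omega) * lambda * Rpower p (n / 2)) * V_SB omega n lambda V0 p).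
Proof.
intros n2 p_pos; unfold V_SB.
set (c := 2 * sqrt (6 * omega) * lambda / (n + 2)).
pose proof (is_derive_Rpower (1 + n / 2) p p_pos) as dP.
replace (1 + n / 2 - 1) with (n / 2) in dP by ring.
evar_last.
- apply (is_derive_comp (fun z => V0 * exp (- (c * z)))
    (fun q => Rpower q (1 + n / 2))); [auto_derive; trivial | exact dP].
- unfold scal; simpl; unfold mult; simpl; unfold c; field; lra.
Qed.

Lemma E_autonomous (gamma lambda V0 : R) :
  0 < V0 ->
  forall (I : R -> Prop) (H rho phi : R -> R),
  is_interval I -> E_solution gamma (V_E lambda V0) I H rho phi ->
  autonomous_system gamma lambda I H
    (fun t => dot I phi t / (sqrt 6 * H t))
    (fun t => sqrt (V_E lambda V0 (phi t)) / (sqrt 3 * H t)).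
Proof.
intros V0_pos I H rho phi HI
  [smooth_H _ smooth_phi H_pos friedmann raychaudhuri klein_gordon _].
apply (autonomous_system_of_velocity gamma lambda I H rho (dot I phi)
  (fun t => V_E lambda V0 (phi t)) (dot I H) (dot I (dot I phi))
  (fun t => - (sqrt 6 * lambda) * V_E lambda V0 (phi t) * dot I phi t));
  trivial; intros t It.
- apply V_E_pos, V0_pos.
- apply ex_dot_correct; trivial; exact (smooth_H 0%nat t It).
- apply ex_dot_correct; trivial; exact (smooth_phi 1%nat t It).
- apply is_dot_comp; [| apply is_derive_V_E].
  apply ex_dot_correct; trivial; exact (smooth_phi 0%nat t It).
- rewrite (klein_gordon t It), (is_derive_unique _ _ _ (is_derive_V_E _ _ _)); ring.
- ring.
Qed.

Lemma SB_autonomous (gamma omega n lambda V0 : R) :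
  0 < omega -> n <> -2 -> 0 < V0 ->
  forall (I : R -> Prop) (H rho phi : R -> R),
  is_interval I -> SB_solution gamma omega n (V_SB omega n lambda V0) I H rho phi ->
  autonomous_system gamma lambda I H
    (fun t => sqrt (omega / 6) * Rpower (phi t) (n / 2) * (dot I phi t / H t))
    (fun t => sqrt (V_SB omega n lambda V0 (phi t)) / (sqrt 3 * H t)).
Proof.
intros omega_pos n2 V0_pos I H rho phi HI
  [smooth_H _ smooth_phi H_pos phi_pos friedmann raychaudhuri klein_gordon _].
assert (romega : 0 < sqrt omega) by (apply sqrt_lt_R0; lra).
assert (romega_sqr : sqrt omega ^ 2 = omega) by (apply pow2_sqrt; lra).
assert (r6 : 0 < sqrt 6) by (apply sqrt_lt_R0; lra).
replace (fun t => sqrt (omega / 6) * Rpower (phi t) (n / 2) * (dot I phi t / H t))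
  with (fun t => sqrt omega * (Rpower (phi t) (n / 2) * dot I phi t)
                 / (sqrt 6 * H t)).
(* The two forms agree at every [t], even outside [I]: [Rinv_mult] holds also for zero factors. *)
2: { apply functional_extensionality; intro t.
     rewrite sqrt_div by lra; unfold Rdiv; rewrite Rinv_mult; ring. }
assert (dphi : forall t, I t -> is_dot I phi t (dot I phi t)).
{ intros t It; apply ex_dot_correct; trivial; exact (smooth_phi 0%nat t It). }
apply (autonomous_system_of_velocity gamma lambda I H rho
  (fun t => sqrt omega * (Rpower (phi t) (n / 2) * dot I phi t))
  (fun t => V_SB omega n lambda V0 (phi t)) (dot I H)
  (* The unsimplified output of the product rule; [0] is the derivative of the constant
     [sqrt omega]. *)
  (fun t => 0 * (Rpower (phi t) (n / 2) * dot I phi t)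
     + sqrt omega * (n / 2 * Rpower (phi t) (n / 2 - 1) * dot I phi t * dot I phi t
                     + Rpower (phi t) (n / 2) * dot I (dot I phi) t))
  (fun t => - (sqrt (6 * omega) * lambda * Rpower (phi t) (n / 2))
            * V_SB omega n lambda V0 (phi t) * dot I phi t));
  trivial; intros t It.
- apply V_SB_pos, V0_pos.
- apply ex_dot_correct; trivial; exact (smooth_H 0%nat t It).
- apply (is_dot_mult I (fun _ => sqrt omega)
    (fun s => Rpower (phi s) (n / 2) * dot I phi s)); [apply is_dot_const |].
  apply (is_dot_mult I (fun s => Rpower (phi s) (n / 2)) (dot I phi)).
  + apply (is_dot_comp I phi (fun q => Rpower q (n / 2))); [exact (dphi t It) |].
    apply is_derive_Rpower, phi_pos, It.
  + apply ex_dot_correct; trivial; exact (smooth_phi 1%nat t It).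
- apply (is_dot_comp I phi (V_SB omega n lambda V0)); [exact (dphi t It) |].
  apply is_derive_V_SB; [exact n2 | apply phi_pos, It].
- rewrite (friedmann t It), (Rpower_half_sqr _ n), !Rpow_mult_distr, romega_sqr; lra.
- rewrite (raychaudhuri t It), (Rpower_half_sqr _ n), !Rpow_mult_distr, romega_sqr; ring.
- specialize (klein_gordon t It); specialize (phi_pos t It).
  rewrite (is_derive_unique _ _ _ (is_derive_V_SB omega n lambda V0 _ n2 phi_pos)),
    (Rpower_half_sqr _ n), sqrt_mult in klein_gordon by lra.
  assert (P_pos : 0 < Rpower (phi t) (n / 2)) by apply exp_pos.
  (* This turns the derivative of [phi^(n/2)] into the friction-like term
     [n / 2 * (dphi/dt)^2 / phi], which then cancels. *)
  assert (P_pred : Rpower (phi t) (n / 2 - 1) = Rpower (phi t) (n / 2) / phi t).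
  { unfold Rminus; rewrite Rpower_plus, Rpower_Ropp, Rpower_1 by lra; reflexivity. }
  rewrite P_pred.
  match type of klein_gordon with ?a + ?b + ?c = ?d =>
    replace (dot I (dot I phi) t) with (d - b - c) by lra end.
  (* With [omega] as a square, the factors [sqrt omega] of the velocity and of [sqrt (6 * omega)]
     cancel it. *)
  replace (1 / (omega * Rpower (phi t) (n / 2) ^ 2))
    with (1 / (sqrt omega ^ 2 * Rpower (phi t) (n / 2) ^ 2))
    by (rewrite romega_sqr; reflexivity).
  field; lra.
- rewrite sqrt_mult by lra; ring.
Qed.

Theorem mainTheorem4 :
  forall gamma omega n lambda V0 : R,
  0 <= gamma <= 2 -> 0 < omega -> n <> -2 -> 0 <= lambda -> 0 < V0 ->
  (forall (I : R -> Prop) (H rho phi : R -> R),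
     is_interval I ->
     SB_solution gamma omega n (V_SB omega n lambda V0) I H rho phi ->
     autonomous_system gamma lambda I H
       (fun t => sqrt (omega / 6) * Rpower (phi t) (n / 2) * (dot I phi t / H t))
       (fun t => sqrt (V_SB omega n lambda V0 (phi t)) / (sqrt 3 * H t)))
  /\
  (forall (I : R -> Prop) (H rho phi : R -> R),
     is_interval I ->
     E_solution gamma (V_E lambda V0) I H rho phi ->
     autonomous_system gamma lambda I H
       (fun t => dot I phi t / (sqrt 6 * H t))
       (fun t => sqrt (V_E lambda V0 (phi t)) / (sqrt 3 * H t)))
  /\
  (forall phi varphi : R, 0 < phi ->
     varphi = 2 * sqrt omega / (n + 2) * Rpower phi ((n + 2) / 2) ->
     V_SB omega n lambda V0 phi = V_E lambda V0 varphi).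
Proof.
intros gamma omega n lambda V0 _ omega_pos n2 _ V0_pos; split; [| split].
- exact (SB_autonomous gamma omega n lambda V0 omega_pos n2 V0_pos).
- exact (E_autonomous gamma lambda V0 V0_pos).
- intros phi varphi phi_pos ->; unfold V_SB, V_E.
  (* Splitting [sqrt (6 * omega)] exposes the factor [sqrt omega] of [varphi], after which the
     exponents coincide. *)
  rewrite sqrt_mult by lra.
  replace ((n + 2) / 2) with (1 + n / 2) by field.
  do 2 f_equal; field; lra.
Qed.
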